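(* Let $(p_j)_{j=0}^\infty$ be a sequence of orthonormal polynomials (with respect to a weight function $w$ as in the context) with three-term recurrence $$xp_0(x)=a_0p_0(x)+b_0p_1(x),\qquad xp_k(x)=b_{k-1}p_{k-1}(x)+a_kp_k(x)+b_kp_{k+1}(x),\quad k\ge1,$$ where $b_k>0$ for all $k$. Let $\mathbf A\in\mathbb C^{n\times n}$, $\mathbf B\in\mathbb C^{m\times m}$, $\mathbf C\in\mathbb C^{m\times n}$ and $$\mathbf H=\begin{pmatrix}\mathbf A&\mathbf 0\\ \mathbf C&\mathbf B\end{pmatrix}.$$ Then for every $j\ge0$ the lower-left $m\times n$ block of $p_j(\mathbf H)$ is $$\mathbf C\,p_j(\mathbf A)+\mathbf G_j,$$ where the matrices $\mathbf G_j\in\mathbb C^{m\times n}$ satisfy $$\mathbf G_0=-\mathbf C,\qquad \mathbf G_1=\frac1{b_0}\bigl(\mathbf G_0\mathbf A+(a_0+1)\mathbf C\bigr),$$ $$\mathbf G_j=\frac1{b_{j-1}}\bigl(\mathbf G_{j-1}\mathbf A+p_{j-1}(\mathbf B)\mathbf C-a_{j-1}\mathbf G_{j-1}-b_{j-2}\mathbf G_{j-2}\bigr),\quad j\ge2.$$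
   Context: A weight function $w$ is a nonnegative function supported on a finite union $\Sigma\subset\mathbb R$ of disjoint intervals, continuous and positive on the interior of $\Sigma$, with $\int_\Sigma w(x)\,dx=1$. Its orthonormal polynomials $(p_j)_{j\ge0}$ are the polynomials with $\deg p_j=j$ and positive leading coefficient satisfying $\int_\Sigma p_j(x)p_k(x)w(x)\,dx=\delta_{jk}$; in particular $p_0=1$ because $w$ has total mass one. *)

(* Defs.v *)
From mathcomp Require Export all_boot all_order all_algebra.
From mathcomp Require Export all_classical all_reals all_analysis.
From mathcomp Require Export complex.
Export Order.TTheory GRing.Theory Num.Theory.
Export numFieldNormedType.Exports.

Set Implicit Arguments.
Unset Strict Implicit.
Unset Printing Implicit Defensive.

Local Open Scope classical_set_scope.
Local Open Scope ring_scope.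
Local Open Scope complex_scope.

Definition finite_interval_union (R : realType) (Sigma : set R) : Prop :=
  exists (N : nat) (I : 'I_N -> interval R),
    trivIset setT (fun k => [set` I k]) /\
    Sigma = \bigcup_(k in setT) [set` I k].

(* The values of w at the endpoints of Sigma are unconstrained apart from
   being nonnegative, so that weights that are unbounded near an endpoint are
   covered. *)
Record is_weight (R : realType) (Sigma : set R) (w : R -> R) : Prop :=
  IsWeight {
    weight_domain : finite_interval_union Sigma;
    weight_ge0 : forall x, 0 <= w x;
    weight_supported : forall x, ~ Sigma x -> w x = 0;
    weight_continuous : forall x, interior Sigma x -> {for x, continuous w};
    weight_gt0 : forall x, interior Sigma x -> 0 < w x;
    weight_mass :
      (\int[lebesgue_measure]_(x in Sigma) (w x)%:E = 1)%E
  }.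

(* The integrals are extended-real valued and +oo - +oo = -oo, so a finite
   value already forces both the positive and the negative part of the
   integrand to have a finite integral: no integrand is silently
   non-integrable. *)
Record orthonormal_polys (R : realType) (Sigma : set R) (w : R -> R)
    (p : nat -> {poly R}) : Prop :=
  OrthonormalPolys {
    ortho_size : forall j, size (p j) = j.+1;
    ortho_lead_gt0 : forall j, 0 < lead_coef (p j);
    ortho_integral : forall j k,
      (\int[lebesgue_measure]_(x in Sigma) ((p j).[x] * (p k).[x] * w x)%:E
       = ((j == k)%:R : R)%:E)%E
  }.

Definition three_term_recurrence (R : realType) (p : nat -> {poly R})
    (a b : nat -> R) : Prop :=
  'X * p 0%N = a 0%N *: p 0%N + b 0%N *: p 1%N /\
  forall k : nat, (1 <= k)%N ->
    'X * p k = b k.-1 *: p k.-1 + a k *: p k + b k *: p k.+1.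

Definition cpolymx (R : realType) (n : nat) (p : {poly R})
    (M : 'M[R[i]]_n.+1) : 'M[R[i]]_n.+1 :=
  horner_mx M (map_poly (real_complex R) p).

(* Main.v *)
From HB Require Import structures.
Require Import Defs.

Set Implicit Arguments.
Unset Strict Implicit.
Unset Printing Implicit Defensive.

Local Open Scope classical_set_scope.
Local Open Scope ring_scope.
Local Open Scope complex_scope.

(** Write L q for the lower-left block of q(H), and consider the defect
    G q := L q - C q(A), which is linear in q.  Since H is block lower
    triangular, q(H) has diagonal blocks q(A) and q(B), so reading off the
    lower-left block of (X q)(H) = q(H) H gives L (X q) = L q A + q(B) C;
    as C (X q)(A) = C q(A) A, the defect obeys the same rule,
      G (X q) = G q A + q(B) C            ([block_defect_mulX]).
    Applying G to the three-term recurrence and dividing by b_(j-1) is then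
    exactly the recurrence for G_j := G p_j, and L p_j = C p_j(A) + G_j holds
    by definition.

    The initial values rest on p_0 = 1, for which L 1 = 0 and hence G 1 = - C.
    That p_0 = 1 comes from the normalization: p_0 is a positive constant c
    with c ^ 2 times the mass of w equal to 1, and w has mass 1
    ([orthonormal_poly0]).  The constant c ^ 2 moves out of the integral because
    the integral of a nonnegative function is a supremum over the simple
    functions below it, and scaling permutes simple functions
    ([ge0_integral_scale]). *)

Section nonnegative_scaling.
Context d (T : measurableType d) (R : realType).
Variables (mu : {measure set T -> \bar R}) (D : set T) (f : T -> R).
Hypothesis f0 : forall x, D x -> 0 <= f x.

Import HBNNSimple.

(** Scaling by c maps the simple functions below f to simple functions below
    c f. *)
Lemma ge0_integral_scale_ge (c : R) : 0 < c ->
  (c%:E * \int[mu]_(x in D) (f x)%:E <= \int[mu]_(x in D) (c * f x)%:E)%E.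
Proof.
move=> c0.
rewrite ge0_integralE; last by move=> x /f0; rewrite lee_fin.
rewrite [leRHS]ge0_integralE; last first.
  by move=> x /f0 ?; rewrite lee_fin mulr_ge0// ltW.
rewrite -lee_pdivlMl//; apply: ge_ereal_sup => _ [h hf <-].
rewrite lee_pdivlMl// -sintegralrM.
apply: ereal_sup_ubound; exists (scale_nnsfun h (ltW c0)) => //= x.
have := hf x; rewrite /patch; case: ifPn => _.
  by rewrite !lee_fin => hfx; rewrite ler_pM2l.
by rewrite !lee_fin => hx0; rewrite mulr_ge0_le0// ltW.
Qed.

End nonnegative_scaling.

(** The upper bound is [ge0_integral_scale_ge] applied to c f and c^-1. *)
Lemma ge0_integral_scale d (T : measurableType d) (R : realType)
    (mu : {measure set T -> \bar R}) (D : set T) (f : T -> R) (c : R) :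
  (forall x, D x -> 0 <= f x) -> 0 < c ->
  (\int[mu]_(x in D) (c * f x)%:E = c%:E * \int[mu]_(x in D) (f x)%:E)%E.
Proof.
move=> f0 c0; apply/eqP; rewrite eq_le ge0_integral_scale_ge// andbT.
have ci0 : 0 < c^-1 by rewrite invr_gt0.
have cf0 x : D x -> 0 <= c * f x by move=> /f0 ?; rewrite mulr_ge0// ltW.
have := ge0_integral_scale_ge mu cf0 ci0.
rewrite lee_pdivrMl//; congr (_ <= _ * _)%E.
by apply: eq_integral => x _; rewrite mulKf// gt_eqF.
Qed.

(** Two positive constants with the same square agree, so the positive leading
    coefficient and the unit mass of w determine p_0. *)
Lemma orthonormal_poly0 (R : realType) (Sigma : set R) (w : R -> R)
    (p : nat -> {poly R}) :
  is_weight Sigma w -> orthonormal_polys Sigma w p -> p 0%N = 1.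
Proof.
move=> hw hp.
have [c p0E] : exists c, p 0%N = c%:P.
  by exists (p 0%N)`_0; apply: size1_polyC; rewrite (ortho_size hp).
have c0 : 0 < c by have := ortho_lead_gt0 hp 0; rewrite p0E lead_coefC.
have := ortho_integral hp 0 0; rewrite p0E /=.
under eq_integral do rewrite hornerC.
rewrite ge0_integral_scale ?mulr_gt0//; last first.
  by move=> x _; exact: weight_ge0 hw x.
rewrite (weight_mass hw) mule1 => -[] /eqP.
by rewrite -expr2 sqrp_eq1 ?ltW// => /eqP ->.
Qed.

Section block_lower.
Context (F : comNzRingType) (n m : nat).
Variables (A : 'M[F]_n.+1) (B : 'M[F]_m.+1) (C : 'M[F]_(m.+1, n.+1)).

Let H : 'M[F]_(n.+1 + m.+1) := block_mx A 0 C B.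

Implicit Types q : {poly F}.

Definition horner_dl q : 'M[F]_(m.+1, n.+1) :=
  dlsubmx (horner_mx H q : 'M[F]_(n.+1 + m.+1)).

Lemma horner_mx_block_lower q :
  horner_mx H q = block_mx (horner_mx A q) 0 (horner_dl q) (horner_mx B q).
Proof.
rewrite /horner_dl; elim/poly_ind: q => [|q c IH].
  by rewrite !rmorph0 -[0](@block_mx0 _ n.+1 m.+1 n.+1 m.+1) block_mxKdl.
rewrite !rmorphD !rmorphM /= !horner_mx_X !horner_mx_C IH.
rewrite -[_ * H]/(_ *m _) mulmx_block !mulmx0 !mul0mx !addr0 !add0r.
rewrite (@scalar_mx_block _ n.+1 m.+1).
by rewrite (@add_block_mx _ n.+1 m.+1 n.+1 m.+1) !addr0 block_mxKdl.
Qed.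

Lemma horner_dl_mulX q :
  horner_dl ('X * q) = horner_dl q *m A + horner_mx B q *m C.
Proof.
rewrite [LHS]/horner_dl mulrC rmorphM /= horner_mx_X horner_mx_block_lower.
by rewrite -[_ * H]/(_ *m _) mulmx_block block_mxKdl.
Qed.

(** The correction between the lower-left block of q(H) and C q(A); the matrix
    G_j is its value at p_j. *)
Definition block_defect q : 'M[F]_(m.+1, n.+1) :=
  horner_dl q - C *m horner_mx A q.

Lemma block_defect_is_linear : linear block_defect.
Proof.
move=> c q r; rewrite /block_defect.
have -> : horner_dl (c *: q + r) = c *: horner_dl q + horner_dl r.
  by apply/matrixP => i j; rewrite /horner_dl !linearP !mxE.
by rewrite linearP mulmxDr -scalemxAr scalerBr opprD addrACA.
Qed.

HB.instance Definition _ :=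
  GRing.isLinear.Build F {poly F} 'M[F]_(m.+1, n.+1) _ block_defect
    block_defect_is_linear.

Lemma block_defect1 : block_defect 1 = - C.
Proof.
rewrite /block_defect /horner_dl !rmorph1 mulmx1.
by rewrite -[1]/(1%:M) (@scalar_mx_block _ n.+1 m.+1) block_mxKdl sub0r.
Qed.

(** The term C q(A) cancels because (X q)(A) = q(A) A also has its new factor
    A on the right. *)
Lemma block_defect_mulX q :
  block_defect ('X * q) = block_defect q *m A + horner_mx B q *m C.
Proof.
rewrite /block_defect horner_dl_mulX mulrC rmorphM /= horner_mx_X.
by rewrite mulmxBl mulmxA addrAC.
Qed.

End block_lower.

Theorem lemma3p3 (R : realType) (Sigma : set R) (w : R -> R)
    (p : nat -> {poly R}) (a b : nat -> R) (n m : nat)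
    (A : 'M[R[i]]_n.+1) (B : 'M[R[i]]_m.+1) (C : 'M[R[i]]_(m.+1, n.+1))
    (hw : is_weight Sigma w)
    (hp : orthonormal_polys Sigma w p)
    (hb : forall k, 0 < b k)
    (hrec : three_term_recurrence p a b) :
  let H : 'M[R[i]]_(n.+1 + m.+1) := block_mx A 0 C B in
  exists G : nat -> 'M[R[i]]_(m.+1, n.+1),
    [/\ G 0%N = - C,
        G 1%N = (1 / b 0%N)%:C *: (G 0%N *m A + (a 0%N + 1)%:C *: C),
        forall j : nat, (2 <= j)%N ->
          G j = (1 / b j.-1)%:C *:
                  (G j.-1 *m A + cpolymx (p j.-1) B *m C
                   - (a j.-1)%:C *: G j.-1 - (b j.-2)%:C *: G j.-2)
      & forall j : nat,
          dlsubmx (cpolymx (p j) H : 'M[R[i]]_(n.+1 + m.+1))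
            = C *m cpolymx (p j) A + G j].
Proof.
move=> H; have [rec0 recS] := hrec; have p0 := orthonormal_poly0 hw hp.
pose pc j : {poly R[i]} := map_poly (real_complex R) (p j).
have pc0 : pc 0%N = 1 by rewrite /pc p0 rmorph1.
have bK k (M : 'M[R[i]]_(m.+1, n.+1)) : (1 / b k)%:C *: ((b k)%:C *: M) = M.
  by rewrite scalerA -rmorphM /= div1r mulVf ?gt_eqF// rmorph1 scale1r.
exists (fun j => block_defect A B C (pc j)); split.
- by rewrite pc0 block_defect1.
- have : 'X * pc 0%N = (a 0%N)%:C *: pc 0%N + (b 0%N)%:C *: pc 1%N.
    by rewrite /pc -!map_polyZ -rmorphD -rec0 rmorphM /= map_polyX.
  move=> /(congr1 (block_defect A B C)) E.
  rewrite block_defect_mulX pc0 rmorph1 mul1mx linearD !linearZ /= in E.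
  move: E; rewrite pc0 block_defect1 => /esym/(canRL (addKr _)) E.
  rewrite -[LHS](bK 0%N) E; congr (_ *: _).
  (* One C is p_0(B) C, and the a_0 C is - a_0 G_0 with G_0 = - C. *)
  by rewrite scalerN opprK rmorphD rmorph1 scalerDl scale1r addrCA.
- case=> [|[|j]] // _ /=.
  have : 'X * pc j.+1 =
      (b j)%:C *: pc j + (a j.+1)%:C *: pc j.+1 + (b j.+1)%:C *: pc j.+2.
    by rewrite /pc -!map_polyZ -!rmorphD -(recS j.+1)// rmorphM /= map_polyX.
  move=> /(congr1 (block_defect A B C)) E.
  rewrite block_defect_mulX !linearD !linearZ /= in E.
  move/esym/(canRL (addKr _)) in E.
  rewrite -[LHS](bK j.+1) E; congr (_ *: _).
  by rewrite /cpolymx -/(pc j.+1) addrC [(b j)%:C *: _ + _]addrC opprD addrA.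
- by move=> j; rewrite /block_defect addrC subrK.
Qed.
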